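(* Let $X$ be a metric space and $n\ge 0$ an integer. Then $\mathrm{asdim}(X)\le n$ if and only if for each $M>0$ there is a uniformly bounded family $\mathcal U$ of subsets of $X$ of Lebesgue number at least $M$ and multiplicity at most $n+1$.
   Context: For a family $\mathcal U$ of subsets of a metric space $X$, $L_{\mathcal U}(x)=\sup_{U\in\mathcal U}\mathrm{dist}(x,X\setminus U)\in[0,\infty]$, with $\mathrm{dist}(x,\emptyset)=\infty$ and the supremum over the empty family equal to $0$; the Lebesgue number of $\mathcal U$ is $L(\mathcal U,X)=\inf_{x\in X}L_{\mathcal U}(x)$. The multiplicity of $\mathcal U$ is the supremum over $x\in X$ of the number of elements of $\mathcal U$ containing $x$. $\mathcal U$ is uniformly bounded if the diameters of its elements are bounded by a common finite number. $\mathcal V$ refines $\mathcal U$ if each element of $\mathcal V$ is contained in some element of $\mathcal U$. For $n\ge0$, $L^n(\mathcal U,X)$ is the supremum of all $t\in[0,\infty]$ such that $\mathcal U$ has a refinement of multiplicity at most $n+1$ and Lebesgue number at least $t$. The asymptotic dimension $\mathrm{asdim}(X)$ is the smallest integer $n\ge0$ such that the function $\mathcal U\mapsto L^n(\mathcal U,X)$ is coarsely proper on the space of covers of $X$, i.e. $L^n(\mathcal U_k,X)\to\infty$ for every sequence of covers $\mathcal U_k$ of $X$ with $L(\mathcal U_k,X)\to\infty$ ($\infty$ if there is no such $n$). *)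

(* Defs.v *)
From mathcomp Require Import all_boot all_order all_algebra.
From mathcomp Require Import all_classical all_reals all_analysis.

Set Implicit Arguments.
Unset Strict Implicit.
Unset Printing Implicit Defensive.

Import Order.TTheory GRing.Theory Num.Theory.

Local Open Scope classical_set_scope.
Local Open Scope ring_scope.
Local Open Scope ereal_scope.

(* Supremum in [0, +oo]: the supremum of the empty set is 0 (ereal_sup set0 is
   -oo). *)
Definition esup0 (R : realType) (A : set (\bar R)) : \bar R :=
  maxe 0 (ereal_sup A).

(* edist and edist_inf are defined from balls; in a metric space edist is the
   distance function, so that edist_inf A x is dist(x, A), with value +oo when
   A is empty. *)
Lemma edist_mdist (R : realType) (X : metricType R) (x y : X) :
  edist (x, y) = (mdist x y)%:E.
Proof.
apply/eqP; rewrite eq_le; apply/andP; split; last first.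
  apply: le_ereal_inf_tmp => _ [r [_ +]] <-.
  by rewrite ballEmdist /= lee_fin => /ltW.
apply/lee_addgt0Pr => e e0; apply: ereal_inf_lbound.
exists (mdist x y + e)%R => //; split; first by rewrite ltr_wpDl// mdist_ge0.
by rewrite ballEmdist /= ltrDl.
Qed.

Section Families.
Context {R : realType} {X : metricType R}.
Implicit Types (x : X) (A : set X) (F G : set (set X)).

Definition is_cover F : Prop := cover F id = [set: X].

Definition diameter A : \bar R := esup0 [set edist p | p in A `*` A].

Definition uniformly_bounded F : Prop :=
  exists D : R, forall A, F A -> diameter A <= D%:E.

Definition multiplicity F : \bar R :=
  esup0 [set counting [set A | F A /\ A x] | x in [set: X]].

Definition refines G F : Prop :=
  forall B, G B -> exists2 A, F A & B `<=` A.

Definition lebesgue_fun F x : \bar R :=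
  esup0 [set edist_inf (~` A) x | A in F].

Definition lebesgue_number F : \bar R :=
  ereal_inf [set lebesgue_fun F x | x in [set: X]].

(* L^n(F, X) *)
Definition lebesgue_number_mult (n : nat) F : \bar R :=
  esup0 [set t | 0 <= t /\ exists G, [/\ refines G F,
    multiplicity G <= n.+1%:R%:E & t <= lebesgue_number G]].

Definition coarsely_proper (f : set (set X) -> \bar R) : Prop :=
  forall F : nat -> set (set X), (forall k, is_cover (F k)) ->
    lebesgue_number (F k) @[k --> \oo] --> +oo ->
    f (F k) @[k --> \oo] --> +oo.

End Families.

(* The least admissible n, as an extended real; +oo if there is none. *)
Definition asdim (R : realType) (X : metricType R) : \bar R :=
  ereal_inf [set n%:R%:E | n in
    [set n : nat | coarsely_proper (@lebesgue_number_mult R X n)]].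

(* Main.v *)
Require Import Defs.
From mathcomp Require Import all_boot all_order all_algebra.
From mathcomp Require Import all_classical all_reals all_analysis.

Local Open Scope classical_set_scope.
Local Open Scope ring_scope.
Local Open Scope ereal_scope.

Import Order.TTheory GRing.Theory Num.Theory.

(** A set of diameter less than the Lebesgue number of a nonempty family lies
    inside one of its members, so a bounded family refines every nonempty
    family of large enough Lebesgue number ([refines_of_diameter_lt]). Hence
    bounded families of multiplicity at most [n + 1] and large Lebesgue number
    bound [L^n] from below along any sequence of covers whose Lebesgue numbers
    tend to infinity.

    Conversely, the covers by balls of radius [k + 1] have Lebesgue number at
    least [k + 1] ([lebesgue_number_balls]), so coarse properness provides
    refinements of them of multiplicity at most [n + 1] with arbitrarily large
    Lebesgue number; refining a family of balls of fixed radius, they are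
    uniformly bounded ([refines_balls_bounded]).

    It remains to see that [asdim X <= n] amounts to coarse properness of [L^n]
    for this very [n] ([asdim_leP]): the infimum of a nonempty set of naturals
    is attained, and [L^n] increases with [n]. *)

Lemma esup0_ge0 {R : realType} (A : set (\bar R)) : 0 <= esup0 A.
Proof. by rewrite /esup0 le_max lexx. Qed.

Lemma esup0_ubound {R : realType} (A : set (\bar R)) x : A x -> x <= esup0 A.
Proof. by move=> Ax; rewrite /esup0 le_max ereal_sup_ubound ?orbT. Qed.

Lemma ge_esup0 {R : realType} (A : set (\bar R)) y :
  0 <= y -> ubound A y -> esup0 A <= y.
Proof. by move=> y0 Ay; rewrite /esup0 ge_max y0 ge_ereal_sup. Qed.

Lemma esup0_gt {R : realType} (A : set (\bar R)) y :
  0 <= y -> y < esup0 A -> exists2 x, A x & y < x.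
Proof. by move=> y0; rewrite /esup0 lt_max ltNge y0 => /ereal_sup_gt. Qed.

Lemma lebesgue_number_ge0 {R : realType} {X : metricType R}
  (F : set (set X)) : 0 <= lebesgue_number F.
Proof. by apply: le_ereal_inf_tmp => _ [x _ <-]; exact: esup0_ge0. Qed.

Lemma lebesgue_number_mult_ge {R : realType} {X : metricType R} (n : nat)
  (F G : set (set X)) : refines G F -> multiplicity G <= n.+1%:R%:E ->
  lebesgue_number G <= lebesgue_number_mult n F.
Proof.
move=> GF Gn; apply: esup0_ubound; split; first exact: lebesgue_number_ge0.
by exists G.
Qed.

Lemma lebesgue_number_mult_mono {R : realType} {X : metricType R} (m n : nat)
  (F : set (set X)) :
  (m <= n)%N -> lebesgue_number_mult m F <= lebesgue_number_mult n F.
Proof.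
move=> mn; apply: ge_esup0 => [|t [_ [G [GF Gm tG]]]]; first exact: esup0_ge0.
apply: le_trans tG _; apply: lebesgue_number_mult_ge => //.
by apply: le_trans Gm _; rewrite lee_fin ler_nat.
Qed.

Lemma asdim_leP {R : realType} (X : metricType R) (n : nat) :
  asdim X <= n%:R%:E <-> coarsely_proper (@lebesgue_number_mult R X n).
Proof.
split=> [Xn|Hn]; last by apply: ereal_inf_lbound; exists n.
have {Xn} : asdim X < n.+1%:R%:E.
  by apply: le_lt_trans Xn _; rewrite lte_fin ltr_nat.
move=> /ereal_inf_lt[_ [m Hm <-]]; rewrite lte_fin ltr_nat ltnS => mn.
move=> F coverF /(Hm F coverF)/cvgeyPge mF; apply/cvgeyPge => M.
apply: filterS (mF M) => k /le_trans; apply.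
exact: lebesgue_number_mult_mono.
Qed.

(** Every point has its closed [D]-neighbourhood inside some member of [F], and
    a set of diameter at most [D] is contained in the closed [D]-neighbourhood
    of any of its points. Nonemptiness of [F] serves an empty member of [G]. *)
Lemma refines_of_diameter_lt {R : realType} {X : metricType R}
  (F G : set (set X)) (D : \bar R) : F !=set0 ->
  (forall A, G A -> diameter A <= D) -> D < lebesgue_number F -> refines G F.
Proof.
move=> [B0 FB0] GD DF A GA.
have [->|/set0P[y Ay]] := eqVneq A set0; first by exists B0.
have D0 : 0 <= D by apply: le_trans (GD _ GA); exact: esup0_ge0.
have : D < lebesgue_fun F y.
  by apply: lt_le_trans DF _; apply: ereal_inf_lbound; exists y.
move=> /(esup0_gt _ _ D0)[_ [B FB <-]] DB; exists B => // z Az.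
apply: contrapT => nBz; move: DB; rewrite ltNge => /negP; apply.
apply: (@le_trans _ _ (edist (y, z))).
  by apply: ereal_inf_lbound; exists z.
by apply: le_trans (GD _ GA); apply: esup0_ubound; exists (y, z).
Qed.

Lemma lebesgue_number_balls {R : realType} (X : metricType R) (r : R) :
  r%:E <= lebesgue_number (range (fun x : X => ball x r)).
Proof.
apply: le_ereal_inf_tmp => _ [x _ <-].
apply: (@le_trans _ _ (edist_inf (~` ball x r) x)); last first.
  by apply: esup0_ubound; exists (ball x r) => //; exists x.
apply: le_ereal_inf_tmp => _ [y xy <-]; rewrite leNgt; apply/negP.
by move=> /edist_lt_ball.
Qed.

Lemma refines_balls_bounded {R : realType} {X : metricType R} (r : R)
  (G : set (set X)) : (0 < r)%R ->
  refines G (range (fun x : X => ball x r)) -> uniformly_bounded G.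
Proof.
move=> r0 Gr; exists (r + r)%R => A /Gr[_ [x _ <-] Ax].
apply: ge_esup0 => [|_ [[p q] [/= Ap Aq] <-]].
  by rewrite lee_fin addr_ge0 ?ltW.
apply: le_trans (edist_triangle p x q) _; rewrite EFinD edist_sym.
by apply: leeD; apply: edist_fin => //; exact: Ax.
Qed.

Theorem proposition5p6 (R : realType) (X : metricType R) (n : nat) :
  asdim X <= n%:R%:E <->
  (forall M : R, (0 < M)%R ->
    exists F : set (set X), [/\ uniformly_bounded F,
      M%:E <= lebesgue_number F & multiplicity F <= n.+1%:R%:E]).
Proof.
rewrite asdim_leP; split=> [Xn M M0|HX F coverF /cvgeyPgt LF].
- pose B k := range (fun x : X => ball x k.+1%:R).
  have coverB k : is_cover (B k).
    apply/seteqP; split=> // x _; exists (ball x k.+1%:R); first by exists x.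
    exact: ballxx.
  have LB : lebesgue_number (B k) @[k --> \oo] --> +oo.
    apply/cvgeyPge => A; near=> k.
    apply: le_trans (lebesgue_number_balls X k.+1%:R); rewrite lee_fin.
    apply: (@le_trans _ _ k%:R); last by rewrite ler_nat.
    by near: k; exact: nbhs_infty_ger.
  have /cvgeyPgt/(_ M)[k _ /(_ k (leqnn k))] := Xn B coverB LB.
  rewrite /= => /esup0_gt[]; first by rewrite lee_fin ltW.
  move=> t [_ [G [GB Gn tG]]] Mt; exists G; split=> //.
  + exact: refines_balls_bounded GB.
  + exact: le_trans (ltW Mt) tG.
- apply/cvgeyPge => M.
  have M0 : (0 < Num.max M 1)%R by rewrite lt_max ltr01 orbT.
  have [G [[D GD] LG Gn]] := HX _ M0.
  apply: filterS (LF D) => k Dk; apply: (@le_trans _ _ (Num.max M 1)%:E).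
    by rewrite lee_fin le_max lexx.
  have [[x _]|X0] := pselect ([set: X] !=set0).
    apply: le_trans LG _; apply: lebesgue_number_mult_ge => //.
    apply: refines_of_diameter_lt GD Dk.
    have : cover (F k) id x by rewrite coverF.
    by move=> [A FA _]; exists A.
  (* On the empty space a cover may have no members at all, so the empty set
     need not lie in one; there the cover itself has multiplicity 0 and
     infinite Lebesgue number. *)
  apply: le_trans (_ : lebesgue_number (F k) <= _).
    by apply: le_ereal_inf_tmp => _ [x _ <-]; case: X0; exists x.
  apply: lebesgue_number_mult_ge; first by move=> A FA; exists A.
  by apply: ge_esup0 => [|_ [x _ <-]]; [rewrite lee_fin|case: X0; exists x].
Unshelve. all: by end_near. Qed.
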